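(* Let $(X,d,W)$ be a $W$-hyperbolic space, $C\subseteq X$ a convex subset, $T:C\to C$ a nonexpansive mapping with $Fix(T)\neq\emptyset$, $x_0,u\in C$, $(\lambda_n)_{n\in\mathbb N}$, $(\beta_n)_{n\in\mathbb N}$ sequences in $[0,1]$, and let $(x_n)$ be the Tikhonov-Mann iteration $x_{n+1}=(1-\lambda_n)u_n+\lambda_n Tu_n$, where $u_n=(1-\beta_n)u+\beta_n x_n$. Assume $\beta_n>0$ for all $n\in\mathbb N$ and let $\sigma_2,\sigma_3,\sigma_4:\mathbb N\to\mathbb N$ be such that: - $\prod_{n=0}^\infty\beta_{n+1}=0$ with rate of convergence $\sigma_2$; - $\sum_{n=0}^\infty|\beta_{n+1}-\beta_n|$ converges with Cauchy modulus $\sigma_3$; - $\sum_{n=0}^\infty|\lambda_{n+1}-\lambda_n|$ converges with Cauchy modulus $\sigma_4$. Let $p\in Fix(T)$, $M=\max\{d(x_0,p),d(u,p)\}$, and let $K\in\mathbb N^*$ be such that $K\ge M$. Define $\chi:\mathbb N\to\mathbb N$ by $\chi(k)=\max\{\sigma_3(8K(k+1)-1),\ \sigma_4(8K(k+1)-1)\}$ and $P_n=\prod_{i=0}^n\beta_{i+1}$. Suppose moreover that $\psi_0:\mathbb N\to\mathbb N^*$ satisfies $\frac1{\psi_0(k)}\le P_{\chi(3k+2)}$ for all $k\in\mathbb N$. Then the following hold: (i) $(x_n)$ is asymptotically regular with rate of asymptotic regularity $$\widetilde\Sigma(k)=\max\left\{\sigma_2\big(6K(k+1)\psi_0(k)-1\big),\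 \chi(3k+2)+1\right\}+1.$$ (ii) If, furthermore, $\lim_{n\to\infty}\beta_n=1$ with rate of convergence $\sigma_5:\mathbb N\to\mathbb N$, and $\Lambda\in\mathbb N^*$, $N_\Lambda\in\mathbb N$ are such that $\lambda_n\ge\frac1\Lambda$ for all $n\ge N_\Lambda$, then $(x_n)$ is $T$-asymptotically regular with rate of $T$-asymptotic regularity $$\widetilde\Phi(k)=\max\{N_\Lambda,\ \widetilde\Sigma(2\Lambda(k+1)-1),\ \sigma_5(4K\Lambda(k+1)-1)\}.$$
   Context: A $W$-hyperbolic space is a triple $(X,d,W)$ where $(X,d)$ is a metric space and $W:X\times X\times[0,1]\to X$ is a function, with $W(x,y,\lambda)$ denoted by $(1-\lambda)x+\lambda y$, such that for all $x,y,z,w\in X$ and $\lambda,\tilde\lambda\in[0,1]$: (W1) $d(z,W(x,y,\lambda))\le(1-\lambda)d(z,x)+\lambda d(z,y)$; (W2) $d(W(x,y,\lambda),W(x,y,\tilde\lambda))=|\lambda-\tilde\lambda|d(x,y)$; (W3) $W(x,y,\lambda)=W(y,x,1-\lambda)$; (W4) $d(W(x,z,\lambda),W(y,w,\lambda))\le(1-\lambda)d(x,y)+\lambda d(z,w)$. A nonempty $C\subseteq X$ is convex if $W(x,y,\lambda)\in C$ for all $x,y\in C$, $\lambda\in[0,1]$. Thus $u_n=W(u,x_n,\beta_n)$ and $x_{n+1}=W(u_n,Tu_n,\lambda_n)$. $T:C\to C$ is nonexpansive if $d(Tx,Ty)\le d(x,y)$ for all $x,y\in C$; $Fix(T)$ is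 its set of fixed points. $\mathbb N=\{0,1,2,\dots\}$, $\mathbb N^*=\mathbb N\setminus\{0\}$. For a sequence $(a_n)$ in a metric space and $\varphi:\mathbb N\to\mathbb N$: $\varphi$ is a rate of convergence of $(a_n)$ towards $a$ if for all $k\in\mathbb N$ and $n\ge\varphi(k)$, $d(a_n,a)\le\frac1{k+1}$; $\varphi$ is a Cauchy modulus of $(a_n)$ if for all $k\in\mathbb N$, $n\ge\varphi(k)$ and $p\in\mathbb N$, $d(a_{n+p},a_n)\le\frac1{k+1}$. A Cauchy modulus of a convergent series $\sum b_n$ of nonnegative reals is a Cauchy modulus of its sequence of partial sums $\left(\sum_{i=0}^n b_i\right)_n$; a rate of convergence of a convergent product $\prod b_n$ is a rate of convergence of the sequence $\left(\prod_{i=0}^n b_i\right)_n$. $(x_n)$ is asymptotically regular if $d(x_n,x_{n+1})\to0$, and a rate of asymptotic regularity is a rate of convergence of $(d(x_n,x_{n+1}))$ towards $0$. $(x_n)$ is $T$-asymptotically regular if $d(x_n,Tx_n)\to0$, and a rate of $T$-asymptotic regularity is a rate of convergence of $(d(x_n,Tx_n))$ towards $0$. *)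

(* Defs.v *)
From Stdlib Require Import Reals.
Open Scope R_scope.

(* [W] takes an arbitrary real parameter; its values outside [0,1] are
   unconstrained and irrelevant. *)
Record WHyperbolicSpace : Type := {
  whs_metric :> Metric_Space;
  W : Base whs_metric -> Base whs_metric -> R -> Base whs_metric;
  W1 : forall (x y z : Base whs_metric) (l : R), 0 <= l <= 1 ->
    dist whs_metric z (W x y l)
      <= (1 - l) * dist whs_metric z x + l * dist whs_metric z y;
  W2 : forall (x y : Base whs_metric) (l l' : R), 0 <= l <= 1 -> 0 <= l' <= 1 ->
    dist whs_metric (W x y l) (W x y l') = Rabs (l - l') * dist whs_metric x y;
  W3 : forall (x y : Base whs_metric) (l : R), 0 <= l <= 1 ->
    W x y l = W y x (1 - l);
  W4 : forall (x y z w : Base whs_metric) (l : R), 0 <= l <= 1 ->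
    dist whs_metric (W x z l) (W y w l)
      <= (1 - l) * dist whs_metric x y + l * dist whs_metric z w
}.

Arguments W {_} _ _ _.

Definition convex_subset (X : WHyperbolicSpace) (C : Base X -> Prop) : Prop :=
  (exists x, C x) /\
  forall (x y : Base X) (l : R), C x -> C y -> 0 <= l <= 1 -> C (W x y l).

(* A map T : C -> C is represented by a map on the whole space that preserves
   [C]; only its values on [C] matter. *)
Definition self_map {A : Type} (C : A -> Prop) (T : A -> A) : Prop :=
  forall x, C x -> C (T x).

Definition nonexpansive (M : Metric_Space) (C : Base M -> Prop)
    (T : Base M -> Base M) : Prop :=
  forall x y, C x -> C y -> dist M (T x) (T y) <= dist M x y.

Definition Fix {A : Type} (C : A -> Prop) (T : A -> A) (p : A) : Prop :=
  C p /\ T p = p.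

Definition rate_of_convergence (M : Metric_Space) (a : nat -> Base M)
    (l : Base M) (phi : nat -> nat) : Prop :=
  forall k n : nat, (phi k <= n)%nat -> dist M (a n) l <= 1 / (INR k + 1).

Definition cauchy_modulus (M : Metric_Space) (a : nat -> Base M)
    (phi : nat -> nat) : Prop :=
  forall k n p : nat, (phi k <= n)%nat ->
    dist M (a (n + p)%nat) (a n) <= 1 / (INR k + 1).

Definition converges_with_rate (a : nat -> R) (l : R) (phi : nat -> nat) : Prop :=
  Un_cv a l /\ rate_of_convergence R_met a l phi.

Definition product_with_rate (b : nat -> R) (l : R) (phi : nat -> nat) : Prop :=
  converges_with_rate (prod_f_R0 b) l phi.

Definition series_with_cauchy_modulus (b : nat -> R) (phi : nat -> nat) : Prop :=
  (exists l : R, infinite_sum b l) /\ cauchy_modulus R_met (sum_f_R0 b) phi.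

Definition asymptotically_regular_with_rate (M : Metric_Space)
    (x : nat -> Base M) (phi : nat -> nat) : Prop :=
  converges_with_rate (fun n => dist M (x n) (x (S n))) 0 phi.

Definition T_asymptotically_regular_with_rate (M : Metric_Space)
    (T : Base M -> Base M) (x : nat -> Base M) (phi : nat -> nat) : Prop :=
  converges_with_rate (fun n => dist M (x n) (T (x n))) 0 phi.

Fixpoint tikhonov_mann (X : WHyperbolicSpace) (T : Base X -> Base X)
    (x0 u : Base X) (lambda beta : nat -> R) (n : nat) : Base X :=
  match n with
  | O => x0
  | S m =>
      let um := W u (tikhonov_mann X T x0 u lambda beta m) (beta m) in
      W um (T um) (lambda m)
  end.

(* The truncated subtractions below are exact as soon as [K], [psi0 k] and
   [Lambda] are positive. *)
Definition chi (K : nat) (sigma3 sigma4 : nat -> nat) (k : nat) : nat :=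
  (Nat.max (sigma3 (8 * K * (k + 1) - 1)) (sigma4 (8 * K * (k + 1) - 1)))%nat.

Definition Sigma_tilde (K : nat) (sigma2 sigma3 sigma4 psi0 : nat -> nat)
    (k : nat) : nat :=
  (Nat.max (sigma2 (6 * K * (k + 1) * psi0 k - 1))
          (chi K sigma3 sigma4 (3 * k + 2) + 1) + 1)%nat.

Definition Phi_tilde (K Lambda N_Lambda : nat)
    (sigma2 sigma3 sigma4 psi0 sigma5 : nat -> nat) (k : nat) : nat :=
  (Nat.max N_Lambda
    (Nat.max (Sigma_tilde K sigma2 sigma3 sigma4 psi0 (2 * Lambda * (k + 1) - 1))
             (sigma5 (4 * K * Lambda * (k + 1) - 1))))%nat.

(* Main.v *)
Require Import Defs.
From Stdlib Require Import Reals Lra Lia.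
Open Scope R_scope.

(** Write [s n] for the distance [d(x_n, x_{n+1})]. Comparing two consecutive
    steps of the iteration by nonexpansiveness, (W2) and (W4) gives
    [s (n+1) <= beta_{n+1} * s n + c n], where
    [c n = 2K (|beta_{n+1} - beta_n| + |lambda_{n+1} - lambda_n|)]: every
    iterate stays within [K] of the fixed point [p], so each distance that
    multiplies a change of parameter is at most [2K]
    (lemma [iteration_step_recurrence]).

    Iterating the recurrence from an index [N+1] up to [N+1+m] bounds
    [s (N+1+m)] by the product [P_{N+m} / P_N] times [s (N+1)], plus the sum of
    [c i] for [N < i <= N+m] (lemma [product_recurrence_unrolled]). For
    [N = chi (3k+2)] this sum is at most [1 / 6(k+1)]. The lower bound
    [1 / psi0 k <= P_N] pays for the division by [P_N], and [sigma2] makes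
    [P_{N+m}] so small that the first term is at most [1 / 3(k+1)].

    For the distance to [T x_n], go from [x_n] to [T x_n] through [x_{n+1}].
    Nonexpansiveness leaves a term [(1 - lambda_n) d(x_n, T x_n)] on the right,
    which is absorbed on the left:
    [lambda_n d(x_n, T x_n) <= s n + d(u_n, x_n)], and
    [d(u_n, x_n) <= 2K (1 - beta_n)] (lemma [displacement_le]). *)

(** * Rates and real recurrences *)

(** The step from [1 / (k+1)] to every positive [eps] is the Archimedean
    property. *)
Lemma rate_converges (a : nat -> R) (l : R) (phi : nat -> nat) :
  rate_of_convergence R_met a l phi -> converges_with_rate a l phi.
Proof.
  intros Hrate; split; [|exact Hrate].
  intros eps Heps.
  destruct (archimed_cor1 eps Heps) as [k [Hk Hk0]].
  exists (phi k); intros n Hn.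
  apply Rle_lt_trans with (1 / (INR k + 1)); [exact (Hrate k n Hn)|].
  apply Rlt_trans with (/ INR k); [|exact Hk].
  pose proof (lt_0_INR k Hk0).
  unfold Rdiv; rewrite Rmult_1_l; apply Rinv_lt_contravar; nra.
Qed.

Lemma rate_of_nonneg_sequence (a : nat -> R) (phi : nat -> nat) :
  (forall n, 0 <= a n) ->
  (forall k n, (phi k <= n)%nat -> a n <= 1 / (INR k + 1)) ->
  converges_with_rate a 0 phi.
Proof.
  intros Ha Hphi; apply rate_converges; intros k n Hn; simpl; unfold Rdist.
  rewrite Rminus_0_r, Rabs_pos_eq; auto.
Qed.

(** The precision [1 / (k + 1)] makes a modulus take its argument in the form
    [N - 1] whenever [1 / N] is wanted; the subtraction is exact for
    positive [N]. *)
Lemma precision_pred (N : nat) : (1 <= N)%nat -> 1 / (INR (N - 1) + 1) = / INR N.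
Proof.
  intros HN; rewrite <- S_INR; replace (S (N - 1)) with N by lia.
  unfold Rdiv; ring.
Qed.

Lemma partial_sums_monotone (c : nat -> R) (N m : nat) :
  (forall n, 0 <= c n) -> sum_f_R0 c N <= sum_f_R0 c (N + m).
Proof.
  intros Hc; induction m as [|m IH].
  - rewrite Nat.add_0_r; lra.
  - rewrite Nat.add_succ_r; simpl; specialize (Hc (S (N + m))); lra.
Qed.

(** The inequality is kept free of division: both sides are multiplied by the
    product up to [N]. The induction works because the accumulated error is
    nonnegative, so that multiplying it by [b (S (N + m)) <= 1] only
    decreases it. *)
Lemma product_recurrence_unrolled (b c s : nat -> R) :
  (forall n, 0 <= b n <= 1) ->
  (forall n, 0 <= c n) ->
  (forall n, s (S n) <= b n * s n + c n) ->
  forall N m : nat,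
  prod_f_R0 b N * (s (S (N + m)) - (sum_f_R0 c (N + m) - sum_f_R0 c N))
    <= prod_f_R0 b (N + m) * s (S N).
Proof.
  intros Hb Hc Hs N m.
  assert (HP : 0 <= prod_f_R0 b N) by (apply prod_SO_pos; intros; apply Hb).
  induction m as [|m IH].
  - rewrite Nat.add_0_r; lra.
  - rewrite Nat.add_succ_r; cbn [prod_f_R0 sum_f_R0].
    pose proof (partial_sums_monotone c N m Hc) as Hmono.
    specialize (Hs (S (N + m))); destruct (Hb (S (N + m))) as [Hb0 Hb1].
    set (D := sum_f_R0 c (N + m) - sum_f_R0 c N) in *.
    assert (HD : 0 <= D) by (unfold D; lra).
    apply Rle_trans with
      (prod_f_R0 b N * (b (S (N + m)) * (s (S (N + m)) - D))).
    + apply Rmult_le_compat_l; [exact HP|].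
      replace (sum_f_R0 c (N + m) + c (S (N + m)) - sum_f_R0 c N)
        with (D + c (S (N + m))) by (unfold D; ring).
      nra.
    + apply Rmult_le_compat_l with (r := b (S (N + m))) in IH; [|exact Hb0].
      nra.
Qed.

(** * Metric estimates for the iteration *)

(** Closed balls are convex by (W1). *)
Lemma convex_combination_bounded (X : WHyperbolicSpace) (C : Base X -> Prop)
    (u y p : Base X) (b r : R) :
  convex_subset X C -> C u -> C y -> 0 <= b <= 1 ->
  dist X u p <= r -> dist X y p <= r ->
  C (W u y b) /\ dist X (W u y b) p <= r.
Proof.
  intros [_ Hconv] Hu Hy Hb Hup Hyp; split; [apply Hconv; auto|].
  rewrite dist_sym; eapply Rle_trans; [apply W1; exact Hb|].
  rewrite (dist_sym X p u), (dist_sym X p y); nra.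
Qed.

Lemma image_in_ball (X : WHyperbolicSpace) (C : Base X -> Prop)
    (T : Base X -> Base X) (y p : Base X) (r : R) :
  nonexpansive X C T -> Fix C T p -> C y ->
  dist X y p <= r -> dist X (T y) p <= r.
Proof.
  intros HT [Hp HTp] Hy Hyp.
  rewrite <- HTp; eapply Rle_trans; [apply HT; auto|exact Hyp].
Qed.

Lemma tikhonov_mann_bounded (X : WHyperbolicSpace) (C : Base X -> Prop)
    (T : Base X -> Base X) (x0 u p : Base X) (lambda beta : nat -> R) (r : R) :
  convex_subset X C -> self_map C T -> nonexpansive X C T -> Fix C T p ->
  C x0 -> C u ->
  (forall n, 0 <= lambda n <= 1) -> (forall n, 0 <= beta n <= 1) ->
  dist X x0 p <= r -> dist X u p <= r ->
  forall n,
  let xn := tikhonov_mann X T x0 u lambda beta n in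
  C xn /\ dist X xn p <= r.
Proof.
  intros Hconv Hself HT Hfix Hx0 Hu Hl Hb Hx0p Hup n.
  induction n as [|n [IHC IHd]]; simpl; [split; assumption|].
  destruct (convex_combination_bounded X C u _ p (beta n) r Hconv Hu IHC (Hb n) Hup IHd)
    as [HuC Hud].
  apply convex_combination_bounded; auto.
  apply image_in_ball with C; auto.
Qed.

Lemma dist_in_ball (X : Metric_Space) (y z p : Base X) (r : R) :
  dist X y p <= r -> dist X z p <= r -> dist X y z <= 2 * r.
Proof.
  intros Hy Hz; pose proof (dist_tri X y z p) as H.
  rewrite (dist_sym X p z) in H; lra.
Qed.

(** Move the endpoints at a fixed parameter by (W4), then the parameter at
    fixed endpoints by (W2). *)
Lemma dist_W_le (X : WHyperbolicSpace) (y z y' z' : Base X) (l l' : R) :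
  0 <= l <= 1 -> 0 <= l' <= 1 ->
  dist X (W y z l) (W y' z' l')
    <= (1 - l) * dist X y y' + l * dist X z z' + Rabs (l - l') * dist X y' z'.
Proof.
  intros Hl Hl'.
  eapply Rle_trans; [apply (dist_tri X _ _ (W y' z' l))|].
  rewrite W2 by assumption.
  pose proof (W4 X y y' z z' l Hl); lra.
Qed.

(** Here [y] and [y'] stand for the iterates [x_{n+1}] and [x_n]. The anchor [u] is
    common to both, so the factor [b] in front of [dist X y y'] survives the
    averaging with [T]. *)
Lemma iteration_step_recurrence (X : WHyperbolicSpace) (C : Base X -> Prop)
    (T : Base X -> Base X) (u y y' p : Base X) (l l' b b' r : R) :
  convex_subset X C -> nonexpansive X C T -> Fix C T p ->
  C u -> C y -> C y' ->
  0 <= l <= 1 -> 0 <= l' <= 1 -> 0 <= b <= 1 -> 0 <= b' <= 1 ->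
  dist X u p <= r -> dist X y p <= r -> dist X y' p <= r ->
  dist X (W (W u y b) (T (W u y b)) l) (W (W u y' b') (T (W u y' b')) l')
    <= b * dist X y y' + 2 * r * (Rabs (b - b') + Rabs (l - l')).
Proof.
  intros Hconv HT Hfix Hu Hy Hy' Hl Hl' Hb Hb' Hup Hyp Hyp'.
  destruct (convex_combination_bounded X C u y p b r) as [HvC _]; auto.
  destruct (convex_combination_bounded X C u y' p b' r) as [HvC' Hv'p]; auto.
  pose proof (dist_W_le X u y u y' b b' Hb Hb') as Hv.
  rewrite (proj2 (dist_refl X u u) eq_refl), Rmult_0_r in Hv.
  pose proof (dist_in_ball X u y' p r Hup Hyp') as Huy'.
  pose proof (image_in_ball X C T _ p r HT Hfix HvC' Hv'p) as HTv'p.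
  pose proof (dist_in_ball X _ _ p r Hv'p HTv'p) as HvT.
  pose proof (HT _ _ HvC HvC') as HTv.
  set (v := W u y b) in *; set (v' := W u y' b') in *.
  eapply Rle_trans; [apply dist_W_le; assumption|].
  pose proof (Rabs_pos (b - b')); pose proof (Rabs_pos (l - l')).
  nra.
Qed.

(** The route goes through the next iterate, which is a convex combination of
    [W u y b] and its image. Both are compared with [T y], and the resulting
    term [(1 - l) * dist X y (T y)] is absorbed on the left. *)
Lemma displacement_le (X : WHyperbolicSpace) (C : Base X -> Prop)
    (T : Base X -> Base X) (u y p : Base X) (l b r : R) :
  convex_subset X C -> nonexpansive X C T ->
  C u -> C y -> 0 <= l <= 1 -> 0 <= b <= 1 ->
  dist X u p <= r -> dist X y p <= r ->
  l * dist X y (T y)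
    <= dist X y (W (W u y b) (T (W u y b)) l) + 2 * r * (1 - b).
Proof.
  intros Hconv HT Hu Hy Hl Hb Hup Hyp.
  destruct (convex_combination_bounded X C u y p b r) as [HvC _]; auto.
  pose proof (W1 X u y y b Hb) as Hvy.
  rewrite (proj2 (dist_refl X y y) eq_refl), Rmult_0_r, Rplus_0_r in Hvy.
  pose proof (dist_in_ball X y u p r Hyp Hup) as Hyu.
  pose proof (HT _ _ Hy HvC) as HTv.
  set (v := W u y b) in *; set (w := W v (T v) l).
  pose proof (dist_tri X y (T y) w) as Htri.
  pose proof (W1 X v (T v) (T y) l Hl) as Hw; fold w in Hw.
  rewrite (dist_sym X w (T y)) in Htri.
  pose proof (dist_tri X (T y) v y) as Htri'.
  rewrite (dist_sym X (T y) y) in Htri'.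
  assert (Hvb : dist X y v <= 2 * r * (1 - b)) by nra.
  nra.
Qed.

(** * The quantitative theorem *)

(** The two series are watched with the same precision [1 / 8K(k+1)], so that
    the factor [2K] in the recurrence leaves [1 / 2(k+1)] for their sum. *)
Lemma chi_error_tail (d e : nat -> R) (sigma3 sigma4 : nat -> nat) (K k m : nat) :
  (1 <= K)%nat ->
  cauchy_modulus R_met (sum_f_R0 d) sigma3 ->
  cauchy_modulus R_met (sum_f_R0 e) sigma4 ->
  let c := fun n => (d n + e n) * (2 * INR K) in
  let N := chi K sigma3 sigma4 k in
  sum_f_R0 c (N + m) - sum_f_R0 c N <= / (2 * INR (k + 1)).
Proof.
  intros HK Hd He c N; unfold c.
  rewrite <- !scal_sum, !plus_sum.
  set (j := (8 * K * (k + 1) - 1)%nat).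
  assert (HdN : (sigma3 j <= N)%nat) by (unfold N, chi; fold j; lia).
  assert (HeN : (sigma4 j <= N)%nat) by (unfold N, chi; fold j; lia).
  specialize (Hd j N m HdN); specialize (He j N m HeN).
  unfold j in Hd, He; rewrite precision_pred in Hd, He by nia.
  cbn [dist R_met] in Hd, He; unfold Rdist in Hd, He.
  pose proof (Rle_trans _ _ _ (Rle_abs _) Hd) as Hd'.
  pose proof (Rle_trans _ _ _ (Rle_abs _) He) as He'.
  pose proof (lt_0_INR K ltac:(lia)) as HKpos.
  pose proof (lt_0_INR (k + 1) ltac:(lia)) as Hkpos.
  replace (/ (2 * INR (k + 1))) with (2 * INR K * (2 * / INR (8 * K * (k + 1)))).
  - rewrite <- Rmult_minus_distr_l; apply Rmult_le_compat_l; lra.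
  - rewrite !mult_INR; replace (INR 8) with 8 by (simpl; lra).
    field; split; lra.
Qed.

(** [P1] and [P2] are the products up to [N] and [N + m], and [D] is the
    accumulated error. Dividing by [P1 >= 1 / psi] costs a factor [psi], which
    is why [psi] occurs in the precision demanded of [P2]. *)
Lemma contraction_term_le (P1 P2 psi K k1 s D : R) :
  0 < psi -> 0 < K -> 0 < k1 -> 0 <= P2 ->
  / psi <= P1 -> P2 <= / (6 * K * k1 * psi) -> s <= 2 * K ->
  forall t, P1 * (t - D) <= P2 * s -> t <= / (3 * k1) + D.
Proof.
  intros Hpsi HK Hk HP2 HP1 HP2' Hs t Ht.
  pose proof (Rinv_0_lt_compat psi Hpsi) as Hipsi.
  pose proof (Rinv_0_lt_compat (3 * k1) ltac:(lra)) as Hik.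
  destruct (Rle_lt_dec t D) as [Hle|Hlt]; [lra|].
  assert (Hprod : / psi * (t - D) <= / psi * / (3 * k1)).
  { replace (/ psi * / (3 * k1)) with (/ (6 * K * k1 * psi) * (2 * K))
      by (field; lra).
    apply Rle_trans with (P1 * (t - D)); [nra|].
    apply Rle_trans with (P2 * s); [exact Ht|].
    apply Rle_trans with (P2 * (2 * K)); nra. }
  apply Rmult_le_reg_l in Hprod; lra.
Qed.

Theorem theorem4p2 :
  forall (X : WHyperbolicSpace) (C : Base X -> Prop) (T : Base X -> Base X)
    (x0 u : Base X) (lambda beta : nat -> R)
    (sigma2 sigma3 sigma4 : nat -> nat) (p : Base X) (K : nat)
    (psi0 : nat -> nat),
  convex_subset X C ->
  self_map C T ->
  nonexpansive X C T ->
  (exists q, Fix C T q) ->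
  C x0 ->
  C u ->
  (forall n, 0 <= lambda n <= 1) ->
  (forall n, 0 <= beta n <= 1) ->
  (forall n, 0 < beta n) ->
  product_with_rate (fun n => beta (S n)) 0 sigma2 ->
  series_with_cauchy_modulus (fun n => Rabs (beta (S n) - beta n)) sigma3 ->
  series_with_cauchy_modulus (fun n => Rabs (lambda (S n) - lambda n)) sigma4 ->
  Fix C T p ->
  (1 <= K)%nat ->
  Rmax (dist X x0 p) (dist X u p) <= INR K ->
  (forall k, (1 <= psi0 k)%nat) ->
  (forall k, 1 / INR (psi0 k)
     <= prod_f_R0 (fun i => beta (S i)) (chi K sigma3 sigma4 (3 * k + 2)%nat)) ->
  let x := tikhonov_mann X T x0 u lambda beta in
  asymptotically_regular_with_rate X x
    (Sigma_tilde K sigma2 sigma3 sigma4 psi0)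
  /\
  (forall (sigma5 : nat -> nat) (Lambda N_Lambda : nat),
     converges_with_rate beta 1 sigma5 ->
     (1 <= Lambda)%nat ->
     (forall n, (N_Lambda <= n)%nat -> 1 / INR Lambda <= lambda n) ->
     T_asymptotically_regular_with_rate X T x
       (Phi_tilde K Lambda N_Lambda sigma2 sigma3 sigma4 psi0 sigma5)).
Proof.
  intros X C T x0 u lambda beta sigma2 sigma3 sigma4 p K psi0
    Hconv Hself HT _ Hx0 Hu Hl Hb _ [_ Hprod] [_ Hbeta] [_ Hlambda] Hfix HK HM
    Hpsi Hpsi_le x.
  assert (Hx0p : dist X x0 p <= INR K)
    by (eapply Rle_trans; [apply Rmax_l|exact HM]).
  assert (Hup : dist X u p <= INR K)
    by (eapply Rle_trans; [apply Rmax_r|exact HM]).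
  pose proof (lt_0_INR K ltac:(lia)) as HKpos.
  assert (Hx : forall n, C (x n) /\ dist X (x n) p <= INR K)
    by (intros n; apply tikhonov_mann_bounded; assumption).
  set (s := fun n => dist X (x n) (x (S n))).
  set (c := fun n => (Rabs (beta (S n) - beta n) + Rabs (lambda (S n) - lambda n))
                     * (2 * INR K)).
  set (P := prod_f_R0 (fun i => beta (S i))) in *.
  assert (Hc : forall n, 0 <= c n).
  { intros n; unfold c.
    pose proof (Rabs_pos (beta (S n) - beta n)).
    pose proof (Rabs_pos (lambda (S n) - lambda n)); nra. }
  assert (Hs : forall n, s (S n) <= beta (S n) * s n + c n).
  { intros n; unfold s.
    rewrite (dist_sym X (x (S n))), (dist_sym X (x n)).
    eapply Rle_trans.
    - apply (iteration_step_recurrence X C T u (x (S n)) (x n) p) with (r := INR K);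
        auto; apply Hx.
    - unfold c; lra. }
  assert (HP : forall n, 0 <= P n) by (intros n; apply prod_SO_pos; intros; apply Hb).
  assert (HSigma : forall k n, (Sigma_tilde K sigma2 sigma3 sigma4 psi0 k <= n)%nat ->
            s n <= 1 / (INR k + 1)).
  { intros k n Hn; unfold Sigma_tilde in Hn.
    set (N := chi K sigma3 sigma4 (3 * k + 2)) in *.
    (* The last summand [+ 1] of [Sigma_tilde] is there because [P] is evaluated
       at [n - 1 = N + m]. *)
    destruct (Nat.le_exists_sub (S N) n) as [m [Em _]]; [lia|].
    assert (En : n = S (N + m)) by lia; clear Em; subst n.
    pose proof (product_recurrence_unrolled (fun i => beta (S i)) c s
                  (fun i => Hb (S i)) Hc Hs N m) as Hrec; fold P in Hrec.
    assert (Htail : sum_f_R0 c (N + m) - sum_f_R0 c N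
                      <= / (2 * INR (3 * k + 2 + 1)))
      by exact (chi_error_tail _ _ sigma3 sigma4 K (3 * k + 2) m HK Hbeta Hlambda).
    pose proof (lt_0_INR (psi0 k) (Hpsi k)) as Hpsipos.
    pose proof (pos_INR k) as Hkpos.
    specialize (Hprod (6 * K * (k + 1) * psi0 k - 1)%nat (N + m)%nat ltac:(lia)).
    rewrite precision_pred in Hprod by (specialize (Hpsi k); nia).
    cbn [dist R_met] in Hprod; unfold Rdist in Hprod; fold P in Hprod.
    rewrite Rminus_0_r, Rabs_pos_eq in Hprod by apply HP.
    rewrite !mult_INR, plus_INR in Hprod.
    replace (INR 6) with 6 in Hprod by (simpl; lra).
    replace (INR 1) with 1 in Hprod by reflexivity.
    specialize (Hpsi_le k); fold N in Hpsi_le.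
    unfold Rdiv in Hpsi_le; rewrite Rmult_1_l in Hpsi_le.
    assert (Hs2 : s (S N) <= 2 * INR K)
      by (apply dist_in_ball with p; apply Hx).
    pose proof (contraction_term_le (P N) (P (N + m)%nat) (INR (psi0 k)) (INR K)
                  (INR k + 1) (s (S N)) _ Hpsipos HKpos ltac:(lra) (HP _) Hpsi_le
                  Hprod Hs2 _ Hrec) as Hfin.
    replace (INR (3 * k + 2 + 1)) with (3 * (INR k + 1)) in Htail
      by (rewrite !plus_INR, mult_INR; simpl; lra).
    (* The contraction term and the error use up 1/3 + 1/6 of [1 / (k+1)]. *)
    assert (Hi : 0 < / (INR k + 1)) by (apply Rinv_0_lt_compat; lra).
    replace (/ (3 * (INR k + 1))) with (/ 3 * / (INR k + 1)) in Hfin by (field; lra).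
    replace (/ (2 * (3 * (INR k + 1)))) with (/ 6 * / (INR k + 1)) in Htail
      by (field; lra).
    unfold Rdiv; lra. }
  split.
  - apply rate_of_nonneg_sequence; [intros; apply Rge_le, dist_pos|exact HSigma].
  - intros sigma5 Lambda N_Lambda [_ Hbeta1] HLambda HlLambda.
    apply rate_of_nonneg_sequence; [intros; apply Rge_le, dist_pos|].
    intros k n Hn; unfold Phi_tilde in Hn.
    destruct (Hx n) as [HxC Hxp].
    pose proof (displacement_le X C T u (x n) p (lambda n) (beta n) (INR K)
                  Hconv HT Hu HxC (Hl n) (Hb n) Hup Hxp) as Hdisp.
    change (W (W u (x n) (beta n)) (T (W u (x n) (beta n))) (lambda n))
      with (x (S n)) in Hdisp.
    pose proof (HSigma (2 * Lambda * (k + 1) - 1)%nat n ltac:(lia)) as Hsn.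
    unfold s in Hsn; rewrite precision_pred in Hsn by nia.
    specialize (Hbeta1 (4 * K * Lambda * (k + 1) - 1)%nat n ltac:(lia)).
    rewrite precision_pred in Hbeta1 by nia.
    change (Rabs (beta n - 1) <= / INR (4 * K * Lambda * (k + 1))) in Hbeta1.
    rewrite Rabs_minus_sym in Hbeta1.
    pose proof (Rle_trans _ _ _ (Rle_abs _) Hbeta1) as Hbeta2.
    rewrite !mult_INR, plus_INR in Hsn; rewrite !mult_INR, plus_INR in Hbeta2.
    replace (INR 2) with 2 in Hsn by (simpl; lra).
    replace (INR 4) with 4 in Hbeta2 by (simpl; lra).
    replace (INR 1) with 1 in Hsn, Hbeta2 by reflexivity.
    pose proof (lt_0_INR Lambda ltac:(lia)) as HLpos.
    pose proof (pos_INR k) as Hkpos.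
    specialize (HlLambda n ltac:(lia)).
    pose proof (Rge_le _ _ (dist_pos X (x n) (T (x n)))) as Hdpos.
    pose proof (Rinv_0_lt_compat _ HLpos) as HiL.
    unfold Rdiv in HlLambda; rewrite Rmult_1_l in HlLambda.
    apply Rmult_le_reg_l with (/ INR Lambda); [exact HiL|].
    apply Rle_trans with (lambda n * dist X (x n) (T (x n)));
      [apply Rmult_le_compat_r; assumption|].
    eapply Rle_trans; [exact Hdisp|].
    (* Each of the two terms is bounded by half of [1 / (Lambda (k+1))]. *)
    replace (/ INR Lambda * (1 / (INR k + 1))) with
      (/ (2 * INR Lambda * (INR k + 1))
       + 2 * INR K * / (4 * INR K * INR Lambda * (INR k + 1)))
      by (field; lra).
    apply Rplus_le_compat; [exact Hsn|].
    apply Rmult_le_compat_l; [lra|exact Hbeta2].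
Qed.
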